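(* Let $\lambda\in\mathbb{R}$ and let $k\ge 1$ be an integer. For every integer $n\ge 0$, $$\sum_{m=0}^{n}\widehat{D}_{m,\lambda}^{(k)}S_{2}(n,m)=\sum_{l=0}^{n}\binom{n}{l}\frac{\lambda^{n-l}B_{l}}{(n-l+1)^{k}}.$$
   Context: The multiple degenerate Daehee numbers $\widehat{D}_{n,\lambda}^{(k)}$ ($n\ge 0$) are defined by the $k$-fold integral over the unit cube $$\frac{\log(1+t)}{t}\int_{0}^{1}\cdots\int_{0}^{1}(1+t)^{\lambda x_{1}x_{2}\cdots x_{k}}\,dx_{1}dx_{2}\cdots dx_{k}=\sum_{n=0}^{\infty}\widehat{D}_{n,\lambda}^{(k)}\frac{t^{n}}{n!},$$ as a power series in $t$ (for $|t|$ small). The Stirling numbers of the second kind $S_2(n,l)$ are defined by $x^n=\sum_{l=0}^n S_2(n,l)(x)_l$ for $n\ge 0$, where $(x)_0=1$ and $(x)_n=x(x-1)\cdots(x-n+1)$ for $n\ge 1$. The Bernoulli numbers $B_l$ are defined by $\frac{t}{e^t-1}=\sum_{l=0}^\infty B_l\frac{t^l}{l!}$ (so $B_1=-\tfrac12$). Convention: $0^0=1$. *)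

(* Defs.v *)
From Stdlib Require Import Factorial Reals List ClassicalEpsilon.
From Coquelicot Require Import Coquelicot.
Open Scope R_scope.

(* [f t = sum_n a n * t^n / n!] for all sufficiently small [t <> 0].  The point
   0 is excluded because the generating functions below have a removable
   singularity there (Rocq's division would give them a junk value); such an
   expansion still determines the sequence [a]. *)
Definition has_egf (a : nat -> R) (f : R -> R) : Prop :=
  locally' 0 (fun t => is_pseries (fun n => a n / INR (fact n)) t (f t)).

(* The sequence defined by its exponential generating function; it has a
   meaning only when [f] admits such an expansion. *)
Definition egf_coef (f : R -> R) : nat -> R :=
  epsilon (inhabits (fun _ : nat => 0)) (fun a => has_egf a f).

(* Iterated integral of [f] over the cube [0,1]^k, a point of the cube being
   the list of its [k] coordinates. *)
Fixpoint cube_RInt (k : nat) (f : list R -> R) : R :=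
  match k with
  | O => f nil
  | S k' => RInt (fun x => cube_RInt k' (fun xs => f (x :: xs))) 0 1
  end.

Definition daehee_gf (lam : R) (k : nat) (t : R) : R :=
  ln (1 + t) / t *
  cube_RInt k (fun xs => Rpower (1 + t) (lam * fold_right Rmult 1 xs)).

Definition daehee (lam : R) (k : nat) : nat -> R := egf_coef (daehee_gf lam k).

Definition bernoulli : nat -> R := egf_coef (fun t => t / (exp t - 1)).

Fixpoint falling (x : R) (n : nat) : R :=
  match n with
  | O => 1
  | S m => falling x m * (x - INR m)
  end.

(* Only the values [S n l] with [l <= n] are constrained. *)
Definition is_stirling2 (S : nat -> nat -> R) : Prop :=
  forall (n : nat) (x : R), x ^ n = sum_n (fun l => S n l * falling x l) n.

Definition stirling2 : nat -> nat -> R :=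
  epsilon (inhabits (fun _ _ : nat => 0)) is_stirling2.

(* Main.v *)
Require Import Defs.
From Stdlib Require Import Reals Arith Lra Lia Factorial List ClassicalEpsilon.
From Coquelicot Require Import Coquelicot.
Open Scope R_scope.

(** Put [u = ln (1 + t)], so that [t = exp u - 1].  In the variable [u] the
    generating function of the Daehee numbers is the product of
    [u / (exp u - 1)], whose exponential coefficients are the Bernoulli numbers,
    and of the integral over the cube of [exp (lam * u * x1 ... xk)], which
    termwise integration expands as [sum_j (lam * u)^j / (j! * (j+1)^k)]
    ([cube_RInt_exp]).  The exponential coefficients [c n] of the product
    ([daehee_log_coef]) are therefore the right-hand side of the theorem.

    Substituting [u = ln (1 + t)] back replaces [c] by its transform
    [n |-> sum_j s(n,j) * c j] by the Stirling numbers of the first kind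
    ([egf_comp_ln_1p]), so these are the Daehee numbers; and summing them against
    the Stirling numbers of the second kind gives back [c n] ([stirling2_inverts]).

    The numbers in the statement are selected by their defining property, so
    existence and uniqueness have to be proved as well: existence of the Bernoulli
    expansion by inverting the power series of [(exp u - 1) / u], existence of the
    Daehee expansion by the convergence of the Taylor series of the composite
    with [ln (1 + t)], which rests on factorial bounds on the coefficients. *)

(** * The Stirling transform of the first kind *)

(** The transform [n |-> sum_j s(n,j) * a j] by the signed Stirling numbers of the
    first kind, i.e. the image of [falling x n] under the linear functional
    [x ^ j |-> a j].  The recursion reads [falling x (n+1) = (x - n) * falling x n],
    multiplication by [x] being the shift of [a]; it dispenses with the numbers
    [s(n,j)] themselves. *)
Fixpoint stirling1_transform (n : nat) (a : nat -> R) : R :=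
  match n with
  | O => a O
  | S m => stirling1_transform m (fun j => a (S j))
           - INR m * stirling1_transform m a
  end.

Lemma stirling1_transform_ext (n : nat) : forall a b : nat -> R,
  (forall j, a j = b j) -> stirling1_transform n a = stirling1_transform n b.
Proof.
  induction n as [|n IH]; intros a b H; simpl.
  - apply H.
  - rewrite (IH a b H). rewrite (IH _ (fun j => b (S j))); [reflexivity|].
    intros j; apply H.
Qed.

Lemma stirling1_transform_scal (n : nat) : forall (c : R) (a : nat -> R),
  stirling1_transform n (fun j => c * a j) = c * stirling1_transform n a.
Proof.
  induction n as [|n IH]; intros c a; simpl; [reflexivity|].
  rewrite (IH c a), (IH c (fun j => a (S j))); ring.
Qed.

Lemma stirling1_transform_pow (x : R) (n : nat) :
  stirling1_transform n (fun j => x ^ j) = falling x n.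
Proof.
  induction n as [|n IH]; [reflexivity|]; simpl.
  rewrite (stirling1_transform_scal n x (fun j => x ^ j)), IH; ring.
Qed.

Lemma is_derive_stirling1_transform (n : nat) :
  forall (f : nat -> R -> R) (d : nat -> R) (x : R),
  (forall j, is_derive (f j) x (d j)) ->
  is_derive (fun y => stirling1_transform n (fun j => f j y)) x
    (stirling1_transform n d).
Proof.
  induction n as [|n IH]; intros f d x H; simpl.
  - apply H.
  - apply (is_derive_minus
      (fun y => stirling1_transform n (fun j => f (S j) y))
      (fun y => INR n * stirling1_transform n (fun j => f j y))).
    + apply (IH (fun j => f (S j)) (fun j => d (S j))). intros j; apply H.
    + apply (is_derive_scal (fun y => stirling1_transform n (fun j => f j y))).
      now apply IH.
Qed.

(** The recursion shifts [a], which turns [fact j] into [fact (j + 1)]; the offset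
    [p] makes the bound stable under this shift. *)
Lemma stirling1_transform_bound (K : R) (n : nat) (HK : 0 <= K) :
  forall (a : nat -> R) (M : R) (p : nat), 0 <= M ->
  (forall j, Rabs (a j) <= M * K ^ j * INR (fact (j + p))) ->
  Rabs (stirling1_transform n a) <= M * (K + 1) ^ n * INR (fact (n + p)).
Proof.
  induction n as [|n IH]; intros a M p HM Ha.
  - apply (Ha O).
  - simpl stirling1_transform.
    assert (H1 := IH a M p HM Ha).
    assert (H2 : Rabs (stirling1_transform n (fun j => a (S j)))
        <= (M * K) * (K + 1) ^ n * INR (fact (n + S p))).
    { apply IH; [nra|]. intros j.
      eapply Rle_trans; [apply Ha|]. simpl pow.
      replace (S j + p)%nat with (j + S p)%nat by lia. right; ring. }
    replace (n + S p)%nat with (S (n + p)) in H2 by lia.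
    replace (S n + p)%nat with (S (n + p)) by lia.
    rewrite fact_simpl, mult_INR in H2 |- *.
    set (F := INR (fact (n + p))) in *.
    assert (HF : 0 < F) by (apply lt_0_INR, lt_O_fact).
    assert (HP : 0 <= (K + 1) ^ n) by (apply pow_le; lra).
    assert (Hn := pos_INR n). assert (Hp := pos_INR p).
    rewrite S_INR, plus_INR in *.
    eapply Rle_trans; [apply Rabs_triang|].
    rewrite Rabs_Ropp, Rabs_mult, (Rabs_pos_eq (INR n)) by lra.
    simpl pow.
    assert (HMF : 0 <= M * (K + 1) ^ n * F).
    { apply Rmult_le_pos; [apply Rmult_le_pos|]; lra. }
    set (W := M * (K + 1) ^ n * F) in *.
    replace (M * ((K + 1) * (K + 1) ^ n) * ((INR n + INR p + 1) * F))
      with (W * ((K + 1) * (INR n + INR p + 1))) by (unfold W; ring).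
    replace (M * K * (K + 1) ^ n * ((INR n + INR p + 1) * F))
      with (W * (K * (INR n + INR p + 1))) in H2 by (unfold W; ring).
    assert (INR n * Rabs (stirling1_transform n a) <= INR n * W) by nra.
    nra.
Qed.

(** * Stirling numbers of the second kind and inversion *)

Fixpoint stirling2_rec (n l : nat) : R :=
  match n, l with
  | O, O => 1
  | O, S _ => 0
  | S _, O => 0
  | S n', S l' => stirling2_rec n' l' + INR (S l') * stirling2_rec n' (S l')
  end.

Lemma stirling2_rec_gt (n : nat) : forall l, (n < l)%nat -> stirling2_rec n l = 0.
Proof.
  induction n as [|n IH]; intros [|l] H; try lia; [reflexivity|].
  cbn [stirling2_rec]. rewrite !IH by lia. ring.
Qed.

Lemma sum_f_R0_head (f : nat -> R) (n : nat) :
  sum_f_R0 f (S n) = f O + sum_f_R0 (fun i => f (S i)) n.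
Proof.
  rewrite (decomp_sum f (S n)) by lia; reflexivity.
Qed.

(** Stirling inversion.  For [a j = x ^ j] it is the defining identity of the
    Stirling numbers of the second kind; the same induction works for every [a]. *)
Lemma stirling2_rec_inverts (n : nat) : forall a : nat -> R,
  sum_f_R0 (fun m => stirling2_rec n m * stirling1_transform m a) n = a n.
Proof.
  induction n as [|n IH]; intros a; [simpl; ring|].
  rewrite sum_f_R0_head. cbn [stirling2_rec].
  rewrite <- (IH (fun j => a (S j))).
  assert (H : sum_f_R0 (fun m => INR m * stirling2_rec n m * stirling1_transform m a) n
    = sum_f_R0 (fun m => INR (S m) * stirling2_rec n (S m)
                         * stirling1_transform (S m) a) n).
  { transitivity (sum_f_R0
      (fun m => INR m * stirling2_rec n m * stirling1_transform m a) (S n)).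
    - rewrite tech5, (stirling2_rec_gt n (S n)) by lia. ring.
    - rewrite sum_f_R0_head. simpl (INR 0). ring. }
  transitivity (sum_f_R0 (fun m => stirling2_rec n m * stirling1_transform (S m) a) n
    + sum_f_R0 (fun m => INR m * stirling2_rec n m * stirling1_transform m a) n).
  - rewrite H, <- plus_sum, Rmult_0_l, Rplus_0_l.
    apply sum_eq; intros i _; ring.
  - rewrite <- plus_sum. apply sum_eq; intros i _.
    cbn [stirling1_transform]. ring.
Qed.

Lemma falling_INR_eq_0 (m n : nat) : (m < n)%nat -> falling (INR m) n = 0.
Proof.
  induction n as [|n IH]; intros H; [lia|]; simpl.
  destruct (Nat.eq_dec m n) as [->|Hmn]; [|rewrite IH by lia]; ring.
Qed.

Lemma falling_INR_neq_0 (m n : nat) : (n <= m)%nat -> falling (INR m) n <> 0.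
Proof.
  induction n as [|n IH]; intros H; simpl; [lra|].
  apply Rmult_integral_contrapositive_currified; [apply IH; lia|].
  assert (INR n < INR m) by (apply lt_INR; lia). lra.
Qed.

Lemma sum_f_R0_zero (f : nat -> R) (n : nat) :
  (forall i, (i <= n)%nat -> f i = 0) -> sum_f_R0 f n = 0.
Proof.
  intros H. rewrite (sum_eq f (fun _ => 0) n) by assumption.
  rewrite sum_cte. ring.
Qed.

Lemma sum_f_R0_single (f : nat -> R) (m n : nat) : (m <= n)%nat ->
  (forall i, (i <= n)%nat -> i <> m -> f i = 0) -> sum_f_R0 f n = f m.
Proof.
  induction n as [|n IH]; intros Hm H.
  - replace m with O by lia; reflexivity.
  - rewrite tech5. destruct (Nat.eq_dec m (S n)) as [->|Hne].
    + rewrite sum_f_R0_zero; [ring|]. intros i Hi; apply H; lia.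
    + rewrite IH by (try lia; intros; apply H; lia).
      rewrite (H (S n)) by lia. ring.
Qed.

(** Evaluation at [x = 0, 1, ..., n] is a triangular system with nonzero diagonal,
    since [falling l i = 0] for [i > l]. *)
Lemma falling_coef_unique (d : nat -> R) (n : nat) :
  (forall x, sum_f_R0 (fun l => d l * falling x l) n = 0) ->
  forall l, (l <= n)%nat -> d l = 0.
Proof.
  intros H l. induction l as [l IH] using (well_founded_induction lt_wf); intros Hl.
  assert (E := H (INR l)).
  rewrite (sum_f_R0_single _ l) in E; [|assumption|].
  - apply Rmult_integral in E. destruct E as [E|E]; [exact E|].
    now apply falling_INR_neq_0 in E.
  - intros i Hi Hne. destruct (Nat.lt_ge_cases i l) as [Hil|Hil].
    + rewrite IH by lia. ring.
    + rewrite falling_INR_eq_0 by lia. ring.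
Qed.

Lemma is_stirling2_rec : is_stirling2 stirling2_rec.
Proof.
  intros n x. rewrite sum_n_Reals.
  rewrite <- (stirling2_rec_inverts n (fun j => x ^ j)).
  apply sum_eq; intros i _. now rewrite stirling1_transform_pow.
Qed.

Lemma stirling2_eq_rec (n l : nat) : (l <= n)%nat ->
  stirling2 n l = stirling2_rec n l.
Proof.
  intros Hl.
  assert (HS : is_stirling2 stirling2).
  { unfold stirling2. apply epsilon_spec. exists stirling2_rec. exact is_stirling2_rec. }
  apply Rminus_diag_uniq.
  apply (falling_coef_unique (fun i => stirling2 n i - stirling2_rec n i) n);
    [|exact Hl].
  intros x. assert (E1 := HS n x). assert (E2 := is_stirling2_rec n x).
  rewrite sum_n_Reals in E1, E2.
  transitivity (x ^ n - x ^ n); [|ring].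
  rewrite E1 at 1. rewrite E2. rewrite <- minus_sum.
  apply sum_eq; intros; ring.
Qed.

Lemma stirling2_inverts (a : nat -> R) (n : nat) :
  sum_n (fun m => stirling1_transform m a * stirling2 n m) n = a n.
Proof.
  rewrite sum_n_Reals, <- (stirling2_rec_inverts n a).
  apply sum_eq; intros i Hi. rewrite stirling2_eq_rec by assumption. ring.
Qed.

(** * Uniqueness of exponential generating functions *)

Lemma CV_radius_ge (a : nat -> R) (r M : R) :
  (forall n, Rabs (a n * r ^ n) <= M) -> Rbar_le r (CV_radius a).
Proof.
  intros H. apply (proj1 (CV_radius_bounded a)). now exists M.
Qed.

Lemma CV_radius_pos_of_locally' (a : nat -> R) (f : R -> R) :
  locally' 0 (fun t => is_pseries a t (f t)) -> Rbar_lt 0 (CV_radius a).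
Proof.
  intros [eps He].
  assert (Hp := cond_pos eps).
  assert (H : is_pseries a (eps / 2) (f (eps / 2))).
  { apply He; [|lra]. unfold ball; simpl. unfold AbsRing_ball, abs, minus, plus, opp; simpl.
    rewrite Rabs_pos_eq; lra. }
  apply Rbar_lt_le_trans with (Finite (Rabs (eps / 2))).
  - simpl. rewrite Rabs_pos_eq; lra.
  - apply Rbar_not_lt_le. intros Hlt. apply CV_disk_outside in Hlt. apply Hlt.
    eapply is_lim_seq_ext; [|apply ex_series_lim_0; exists (f (eps / 2)); exact H].
    intros n. unfold scal; simpl. unfold mult; simpl. rewrite pow_n_pow. ring.
Qed.

(** The expansions are only given on a punctured neighbourhood; continuity of
    power series extends their equality to 0. *)
Lemma has_egf_unique (a b : nat -> R) (f : R -> R) (n : nat) :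
  has_egf a f -> has_egf b f -> a n = b n.
Proof.
  intros Ha Hb.
  set (a' := fun n => a n / INR (fact n)). set (b' := fun n => b n / INR (fact n)).
  assert (Ra : Rbar_lt 0 (CV_radius a')) by exact (CV_radius_pos_of_locally' _ _ Ha).
  assert (Rb : Rbar_lt 0 (CV_radius b')) by exact (CV_radius_pos_of_locally' _ _ Hb).
  assert (E' : locally' 0 (fun t => PSeries a' t = PSeries b' t)).
  { generalize (filter_and _ _ Ha Hb). apply filter_imp.
    intros t [H1 H2]. rewrite (is_pseries_unique a' _ _ H1). symmetry.
    now apply (is_pseries_unique b'). }
  assert (E0 : PSeries a' 0 = PSeries b' 0).
  { assert (Ca : is_lim (PSeries a') 0 (PSeries a' 0)).
    { apply is_lim_continuity, PSeries_continuity. now rewrite Rabs_R0. }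
    assert (Cb : is_lim (PSeries b') 0 (PSeries b' 0)).
    { apply is_lim_continuity, PSeries_continuity. now rewrite Rabs_R0. }
    apply (is_lim_ext_loc _ (PSeries b')) in Ca; [|exact E'].
    apply is_lim_unique in Ca. apply is_lim_unique in Cb.
    rewrite Ca in Cb. now injection Cb. }
  assert (E : a' n = b' n).
  { apply PSeries_ext_recip; try assumption.
    destruct E' as [eps He]. exists eps. intros t Ht.
    destruct (Req_dec t 0) as [->|Hne]; [exact E0|]. now apply He. }
  unfold a', b' in E. assert (Hf := INR_fact_neq_0 n).
  apply (Rmult_eq_reg_r (/ INR (fact n))); [exact E|].
  now apply Rinv_neq_0_compat.
Qed.

Lemma egf_coef_eq (a : nat -> R) (f : R -> R) (n : nat) :
  has_egf a f -> egf_coef f n = a n.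
Proof.
  intros Ha. apply (has_egf_unique _ _ f); [|exact Ha].
  unfold egf_coef. apply epsilon_spec. now exists a.
Qed.

(** * Taylor series from bounds on all derivatives *)

Lemma locally_open_interval (x d : R) : Rabs x < d ->
  locally x (fun y => Rabs y < d).
Proof.
  intros H.
  assert (Hp : 0 < d - Rabs x) by lra.
  exists (mkposreal _ Hp). intros y Hy.
  change (Rabs (y - x) < d - Rabs x) in Hy.
  assert (T := Rabs_triang (y - x) x).
  replace (y - x + x) with (y : R) in T by (simpl in *; ring).
  lra.
Qed.

Lemma is_pseries_of_sums (a : nat -> R) (x l : R) :
  is_lim_seq (fun n => sum_f_R0 (fun m => a m * x ^ m) n) l -> is_pseries a x l.
Proof.
  intros H. apply is_pseries_R.
  apply (is_lim_seq_ext _ (sum_n (fun n => a n * x ^ n))) in H; [exact H|].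
  intros n. now rewrite sum_n_Reals.
Qed.

(** Taylor's theorem with Lagrange remainder is applied on [0,1] to
    [s |-> F 0 (s * t)], which treats both signs of [t] at once; the bound makes
    the remainder geometric of ratio [K * |t|]. *)
Lemma taylor_of_derivative_tower (F : nat -> R -> R) (d M K t : R) :
  (forall n x, Rabs x < d -> is_derive (F n) x (F (S n) x)) ->
  (forall n x, Rabs x < d -> Rabs (F n x) <= M * K ^ n * INR (fact n)) ->
  0 <= K -> Rabs t < d -> K * Rabs t < 1 ->
  is_pseries (fun n => F n 0 / INR (fact n)) t (F O t).
Proof.
  intros HF HB HK Ht HKt.
  set (g := fun s => F O (s * t)).
  assert (Hdg : forall n s, Rabs (s * t) < d ->
     Derive_n g n s = t ^ n * F n (s * t) /\ ex_derive_n g n s).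
  { induction n as [|n IH]; intros s Hs.
    - split; [unfold g; simpl; ring|exact I].
    - assert (Hd : is_derive (Derive_n g n) s (t ^ S n * F (S n) (s * t))).
      { apply (is_derive_ext_loc (fun s => t ^ n * F n (s * t))).
        - assert (Hc : continuous (fun s : R => s * t) s).
          { apply (ex_derive_continuous (fun s : R => s * t)). auto_derive. exact I. }
          apply (filter_imp (fun y => Rabs (y * t) < d));
            [|exact (Hc _ (locally_open_interval _ _ Hs))].
          intros y Hy. symmetry. now apply IH.
        - replace (t ^ S n * F (S n) (s * t)) with (t ^ n * (t * F (S n) (s * t)))
            by (simpl; ring).
          apply (is_derive_scal (fun s => F n (s * t))).
          apply (is_derive_comp (F n) (fun s => s * t)).
          + now apply HF.
          + auto_derive; [exact I|ring]. }
      split; [now apply is_derive_unique|].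
      now exists (t ^ S n * F (S n) (s * t)). }
  assert (Hseg : forall s, 0 <= s <= 1 -> Rabs (s * t) < d /\ Rabs (s * t) <= Rabs t).
  { intros s Hs. assert (Ha := Rabs_pos t).
    rewrite Rabs_mult, (Rabs_pos_eq s) by lra. split; nra. }
  apply is_pseries_of_sums.
  assert (Hq : 0 <= K * Rabs t) by (apply Rmult_le_pos; [exact HK|apply Rabs_pos]).
  assert (Hrem : forall n, Rabs (sum_f_R0 (fun m => F m 0 / INR (fact m) * t ^ m) n - F O t)
      <= M * (K * Rabs t) * (K * Rabs t) ^ n).
  { intros n.
    destruct (Taylor_Lagrange g n 0 1) as [z [Hz E]]; [lra| |].
    { intros s Hs k _. now apply Hdg, Hseg. }
    destruct (Hseg z) as [Hz1 _]; [lra|].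
    rewrite (proj1 (Hdg (S n) z Hz1)) in E.
    unfold g in E at 1. rewrite Rmult_1_l in E.
    rewrite (sum_eq _ (fun m => F m 0 / INR (fact m) * t ^ m)) in E.
    2:{ intros i _. rewrite (proj1 (Hdg i 0 ltac:(apply Hseg; lra))).
        rewrite Rminus_0_r, pow1, Rmult_0_l. field. apply INR_fact_neq_0. }
    rewrite E.
    rewrite Rminus_0_r, pow1.
    set (W := sum_f_R0 _ _).
    replace (W - _) with (- (/ INR (fact (S n)) * (t ^ S n * F (S n) (z * t))))
      by (unfold Rdiv; ring).
    rewrite Rabs_Ropp, !Rabs_mult, <- RPow_abs.
    assert (Hfa := INR_fact_lt_0 (S n)).
    rewrite Rabs_pos_eq by (left; now apply Rinv_0_lt_compat).
    replace (M * (K * Rabs t) * (K * Rabs t) ^ n) with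
      (/ INR (fact (S n)) * (Rabs t ^ S n * (M * K ^ S n * INR (fact (S n))))).
    2:{ rewrite Rpow_mult_distr, <- !tech_pow_Rmult. field. lra. }
    apply Rmult_le_compat_l; [left; now apply Rinv_0_lt_compat|].
    apply Rmult_le_compat_l; [apply pow_le, Rabs_pos|]. now apply HB. }
  assert (Hlim : is_lim_seq (fun n => M * (K * Rabs t) * (K * Rabs t) ^ n) 0).
  { replace 0 with (M * (K * Rabs t) * 0) by ring.
    apply (is_lim_seq_scal_l _ _ (Finite 0)). apply is_lim_seq_geom.
    now rewrite Rabs_pos_eq. }
  assert (Hz : is_lim_seq (fun n =>
     sum_f_R0 (fun m => F m 0 / INR (fact m) * t ^ m) n - F O t) 0).
  { apply is_lim_seq_abs_0.
    apply (is_lim_seq_le_le (fun _ => 0) _ _ _ (fun n => conj (Rabs_pos _) (Hrem n)));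
      [apply is_lim_seq_const|exact Hlim]. }
  assert (H := is_lim_seq_plus' _ _ _ _ Hz (is_lim_seq_const (F O t))).
  rewrite Rplus_0_l in H.
  eapply is_lim_seq_ext; [|exact H]. intros n; simpl; ring.
Qed.

Lemma fact_add_le (n : nat) : forall i j, (i + j)%nat = n ->
  INR (fact (i + j)) <= 2 ^ (i + j) * INR (fact i) * INR (fact j).
Proof.
  induction n as [|n IH]; intros [|i] [|j] Hn; try lia.
  - simpl; lra.
  - simpl (0 + _)%nat. assert (H := pow_R1_Rle 2 (S j) ltac:(lra)).
    assert (H1 := INR_fact_lt_0 (S j)). simpl (INR (fact 0)). nra.
  - rewrite Nat.add_0_r. assert (H := pow_R1_Rle 2 (S i) ltac:(lra)).
    assert (H1 := INR_fact_lt_0 (S i)). simpl (INR (fact 0)). nra.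
  - assert (H1 := IH i (S j) ltac:(lia)). assert (H2 := IH (S i) j ltac:(lia)).
    replace (i + S j)%nat with (S (i + j)) in H1 by lia.
    replace (S i + j)%nat with (S (i + j)) in H2 by lia.
    replace (S i + S j)%nat with (S (S (i + j))) by lia.
    rewrite (fact_simpl (S (i + j))), mult_INR.
    rewrite (fact_simpl i), (fact_simpl j), !mult_INR in *.
    rewrite !S_INR, plus_INR in *.
    assert (Hi := pos_INR i). assert (Hj := pos_INR j).
    set (P := 2 ^ S (i + j)) in *. change (2 ^ S (S (i + j))) with (2 * P).
    apply (Rmult_le_compat_l (INR i + 1)) in H1; [|lra].
    apply (Rmult_le_compat_l (INR j + 1)) in H2; [|lra].
    lra.
Qed.

(** * Substituting the logarithm in a generating function *)

(** Coefficients in [u ^ i] of the [j]-th derivative of [sum_i a i * u ^ i / i!]. *)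
Definition egf_shift (a : nat -> R) (j i : nat) : R := a (i + j)%nat / INR (fact i).

(** Binomial coefficients are at most [2 ^ (i + j)], so a factorial bound on [a]
    becomes a geometric bound in [i], uniform in [j] up to [fact j]. *)
Lemma egf_shift_bound (a : nat -> R) (M r : R) (HR : 0 < r)
  (Ha : forall j, Rabs (a j) <= M * r ^ j * INR (fact j)) (j i : nat) :
  Rabs (egf_shift a j i) <= M * (2 * r) ^ j * INR (fact j) * (2 * r) ^ i.
Proof.
  unfold egf_shift, Rdiv. rewrite Rabs_mult, Rabs_inv, (Rabs_pos_eq (INR _)) by apply pos_INR.
  assert (Hi := INR_fact_lt_0 i). assert (Hj := INR_fact_lt_0 j).
  assert (HM : 0 <= M).
  { generalize (Ha O) (Rabs_pos (a O)). simpl. lra. }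
  apply (Rmult_le_reg_r (INR (fact i))); [exact Hi|].
  rewrite Rmult_assoc, Rinv_l, Rmult_1_r by lra.
  eapply Rle_trans; [apply Ha|].
  replace (M * (2 * r) ^ j * INR (fact j) * (2 * r) ^ i * INR (fact i))
    with (M * r ^ (i + j) * (2 ^ (i + j) * INR (fact i) * INR (fact j)))
    by (rewrite !Rpow_mult_distr, !pow_add; ring).
  apply Rmult_le_compat_l; [|now apply (fact_add_le (i + j))].
  apply Rmult_le_pos; [exact HM|apply pow_le; lra].
Qed.

Lemma CV_radius_egf_shift (a : nat -> R) (M r : R) (HR : 0 < r)
  (Ha : forall j, Rabs (a j) <= M * r ^ j * INR (fact j)) (j : nat) :
  Rbar_le (/ (2 * r)) (CV_radius (egf_shift a j)).
Proof.
  apply (CV_radius_ge _ _ (M * (2 * r) ^ j * INR (fact j))). intros i.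
  rewrite Rabs_mult, <- RPow_abs, Rabs_inv, (Rabs_pos_eq (2 * r)) by lra.
  assert (Hp : 0 < (2 * r) ^ i) by (apply pow_lt; lra).
  rewrite pow_inv. apply (Rmult_le_reg_r ((2 * r) ^ i)); [exact Hp|].
  rewrite Rmult_assoc, Rinv_l, Rmult_1_r by lra.
  now apply egf_shift_bound.
Qed.

Lemma is_derive_egf_shift (a : nat -> R) (M r : R) (HR : 0 < r)
  (Ha : forall j, Rabs (a j) <= M * r ^ j * INR (fact j)) (j : nat) (u : R) :
  Rabs u < / (2 * r) ->
  is_derive (PSeries (egf_shift a j)) u (PSeries (egf_shift a (S j)) u).
Proof.
  intros Hu.
  rewrite (PSeries_ext (egf_shift a (S j)) (PS_derive (egf_shift a j))).
  - apply is_derive_PSeries. apply (Rbar_lt_le_trans _ (/ (2 * r)));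
      [exact Hu|now apply (CV_radius_egf_shift a M r)].
  - intros i. unfold PS_derive, egf_shift.
    replace (S i + j)%nat with (i + S j)%nat by lia.
    rewrite fact_simpl, mult_INR. field.
    split; [apply INR_fact_neq_0|now apply not_0_INR].
Qed.

Lemma PSeries_egf_shift_bound (a : nat -> R) (M r : R) (HR : 0 < r)
  (Ha : forall j, Rabs (a j) <= M * r ^ j * INR (fact j)) (j : nat) (u : R) :
  Rabs u <= / (4 * r) ->
  Rabs (PSeries (egf_shift a j) u) <= 2 * M * (2 * r) ^ j * INR (fact j).
Proof.
  intros Hu. set (A := M * (2 * r) ^ j * INR (fact j)).
  assert (Hle : forall i, Rabs (egf_shift a j i * u ^ i) <= A * (/ 2) ^ i).
  { intros i. rewrite Rabs_mult, <- RPow_abs.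
    eapply Rle_trans.
    - apply Rmult_le_compat; [apply Rabs_pos|apply pow_le, Rabs_pos|
        exact (egf_shift_bound a M r HR Ha j i)|apply pow_incr; split; [apply Rabs_pos|exact Hu]].
    - right. unfold A. rewrite Rmult_assoc, <- Rpow_mult_distr.
      replace (2 * r * / (4 * r)) with (/ 2) by (field; lra). reflexivity. }
  assert (Hg : is_series (fun i => A * (/ 2) ^ i) (A * / (1 - / 2))).
  { apply (is_series_scal_l A _ (/ (1 - / 2))), is_series_geom. rewrite Rabs_pos_eq; lra. }
  assert (Hex : ex_series (fun i => Rabs (egf_shift a j i * u ^ i))).
  { apply (ex_series_le (fun i => Rabs (egf_shift a j i * u ^ i)) (fun i => A * (/ 2) ^ i));
      [|now exists (A * / (1 - / 2))].
    intros i. change (Rabs (Rabs (egf_shift a j i * u ^ i)) <= A * (/ 2) ^ i).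
    rewrite Rabs_Rabsolu. apply Hle. }
  unfold PSeries. eapply Rle_trans; [now apply Series_Rabs|].
  apply Rle_trans with (Series (fun i => A * (/ 2) ^ i)).
  - apply Series_le; [|now exists (A * / (1 - / 2))].
    intros i. split; [apply Rabs_pos|apply Hle].
  - rewrite (is_series_unique _ _ Hg). right. unfold A. field.
Qed.

(** Substituting [u = ln (1 + t)] in an exponential generating function applies
    the Stirling transform to its coefficients.  If [f_j] is the [j]-th derivative
    of the series in [u], the [n]-th derivative of the composite is
    [F n t = (1 + t)^(-n) * stirling1_transform n (f_j (ln (1 + t)))_j], because
    differentiating in [t] shifts [j] and brings out one more [1 / (1 + t)],
    while the power [(1 + t)^(-n)] contributes the term [- n]: exactly the
    recursion of the transform.  At [t = 0] the [f_j] take the values [a j], and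
    the factorial bounds make the Taylor series converge. *)
Lemma egf_comp_ln_1p (a : nat -> R) (M r : R) (HR : 0 < r)
  (Ha : forall j, Rabs (a j) <= M * r ^ j * INR (fact j)) :
  locally 0 (fun t => is_pseries (fun n => stirling1_transform n a / INR (fact n)) t
     (PSeries (fun j => a j / INR (fact j)) (ln (1 + t)))).
Proof.
  assert (Hr : 0 < / (4 * r)) by (apply Rinv_0_lt_compat; lra).
  assert (Hr2 : / (4 * r) < / (2 * r)).
  { apply Rinv_lt_contravar; nra. }
  assert (HM : 0 <= M).
  { generalize (Ha O) (Rabs_pos (a O)). simpl. lra. }
  assert (Hc : continuous (fun t => ln (1 + t)) 0).
  { apply (ex_derive_continuous (fun t => ln (1 + t))). auto_derive. lra. }
  assert (Hloc : locally 0 (fun t => Rabs (ln (1 + t)) < / (4 * r))).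
  { apply (Hc (fun y => Rabs y < / (4 * r))). apply locally_open_interval.
    rewrite Rplus_0_r, ln_1, Rabs_R0. exact Hr. }
  destruct Hloc as [e He].
  set (d := Rmin e (/ 2)).
  assert (Hd : 0 < d) by (apply Rmin_glb_lt; [apply cond_pos|lra]).
  assert (Hdom : forall x, Rabs x < d -> / 2 <= 1 + x /\ Rabs (ln (1 + x)) < / (4 * r)).
  { intros x Hx. assert (He1 := Rmin_l e (/ 2)). assert (He2 := Rmin_r e (/ 2)).
    fold d in He1, He2. split.
    - apply Rabs_def2 in Hx. lra.
    - apply He. change (Rabs (x - 0) < e). rewrite Rminus_0_r. lra. }
  (* 2 bounds [/ (1 + t)] and [2 * r + 1] comes from the bound on the transform *)
  set (K := 2 * (2 * r + 1)).
  assert (HK : 0 < K) by (unfold K; lra).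
  set (F := fun n t => / (1 + t) ^ n *
     stirling1_transform n (fun j => PSeries (egf_shift a j) (ln (1 + t)))).
  assert (HF : forall n x, Rabs x < d -> is_derive (F n) x (F (S n) x)).
  { intros n x Hx. destruct (Hdom x Hx) as [H1 H2].
    assert (Hpow : (1 + x) ^ n <> 0) by (apply pow_nonzero; lra).
    unfold F at 2. cbn [stirling1_transform].
    assert (D1 : is_derive (fun t => stirling1_transform n
        (fun j => PSeries (egf_shift a j) (ln (1 + t)))) x
        (/ (1 + x) * stirling1_transform n
          (fun j => PSeries (egf_shift a (S j)) (ln (1 + x))))).
    { rewrite <- stirling1_transform_scal.
      apply (is_derive_stirling1_transform n
        (fun j t => PSeries (egf_shift a j) (ln (1 + t)))).
      intros j. apply (is_derive_comp (PSeries (egf_shift a j)) (fun t => ln (1 + t))).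
      - apply (is_derive_egf_shift a M r HR Ha). lra.
      - auto_derive; [lra|field; lra]. }
    assert (D2 : is_derive (fun t => / (1 + t) ^ n) x (- INR n / (1 + x) ^ S n)).
    { auto_derive; [exact Hpow|]. destruct n as [|n]; [simpl; field; lra|].
      simpl in Hpow |- *.
      assert ((1 + x) ^ n <> 0) by (apply pow_nonzero; lra). field.
      split; [assumption|lra]. }
    assert (D := is_derive_mult _ _ _ _ _ D2 D1 Rmult_comm).
    match type of D with is_derive _ _ ?v =>
      match goal with |- is_derive _ _ ?w => replace w with v; [exact D|] end end.
    unfold plus, mult; simpl. field. split; [exact Hpow|lra]. }
  assert (HB : forall n x, Rabs x < d -> Rabs (F n x) <= (2 * M) * K ^ n * INR (fact n)).
  { intros n x Hx. destruct (Hdom x Hx) as [H1 H2]. unfold F.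
    assert (B := stirling1_transform_bound (2 * r) n ltac:(lra)
      (fun j => PSeries (egf_shift a j) (ln (1 + x))) (2 * M) 0 ltac:(lra)).
    rewrite Nat.add_0_r in B.
    rewrite Rabs_mult.
    replace (2 * M * K ^ n * INR (fact n)) with
      (2 ^ n * (2 * M * (2 * r + 1) ^ n * INR (fact n)))
      by (unfold K; rewrite Rpow_mult_distr; ring).
    apply Rmult_le_compat; try apply Rabs_pos.
    - rewrite Rabs_inv, Rabs_pos_eq by (apply pow_le; lra).
      rewrite <- (Rinv_inv 2), pow_inv.
      apply Rinv_le_contravar; [apply pow_lt; lra|].
      apply pow_incr; lra.
    - apply B. intros j. rewrite Nat.add_0_r. apply (PSeries_egf_shift_bound a M r HR Ha). lra. }
  assert (Hm : Rabs 0 < Rmin d (/ K)).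
  { rewrite Rabs_R0. apply Rmin_glb_lt; [exact Hd|now apply Rinv_0_lt_compat]. }
  generalize (locally_open_interval _ _ Hm). apply filter_imp. intros t Ht.
  assert (Ht1 := Rmin_l d (/ K)). assert (Ht2 := Rmin_r d (/ K)).
  assert (P := taylor_of_derivative_tower F d (2 * M) K t HF HB ltac:(lra) ltac:(lra)).
  replace (PSeries (fun j => a j / INR (fact j)) (ln (1 + t))) with (F O t).
  - eapply is_pseries_ext; [|apply P].
    + intros n. unfold F. simpl. rewrite Rplus_0_r, ln_1, pow1, Rinv_1, Rmult_1_l.
      f_equal. apply stirling1_transform_ext. intros j. rewrite PSeries_0.
      unfold egf_shift. simpl. field.
    + apply (Rmult_lt_reg_l (/ K)); [now apply Rinv_0_lt_compat|].
      rewrite <- Rmult_assoc, Rinv_l, Rmult_1_l, Rmult_1_r by lra. lra.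
  - unfold F. simpl. rewrite Rinv_1, Rmult_1_l. apply PSeries_ext.
    intros i. unfold egf_shift. now rewrite Nat.add_0_r.
Qed.

(** * Exponential integrals over the cube *)

Lemma cube_RInt_ext (k : nat) : forall f g : list R -> R,
  (forall xs, f xs = g xs) -> cube_RInt k f = cube_RInt k g.
Proof.
  induction k as [|k IH]; intros f g H; simpl; [apply H|].
  apply RInt_ext. intros x _. apply IH. intros xs; apply H.
Qed.

Definition cube_exp_coef (k j : nat) : R := / INR (fact j) / INR (j + 1) ^ k.

Lemma cube_exp_coef_bound (k j : nat) : 0 <= cube_exp_coef k j <= / INR (fact j).
Proof.
  assert (Hf := Rinv_0_lt_compat _ (INR_fact_lt_0 j)).
  assert (H1 : 1 <= INR (j + 1) ^ k).
  { apply pow_R1_Rle. rewrite plus_INR. simpl. generalize (pos_INR j). lra. }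
  assert (H2 : 0 < / INR (j + 1) ^ k <= 1).
  { split; [apply Rinv_0_lt_compat; lra|]. rewrite <- Rinv_1.
    apply Rinv_le_contravar; lra. }
  unfold cube_exp_coef, Rdiv. split; nra.
Qed.

Lemma pow_div_fact_le_exp (x : R) (n : nat) : 0 <= x -> / INR (fact n) * x ^ n <= exp x.
Proof.
  intros Hx. eapply Rle_trans; [|apply (exp_ge_taylor x n Hx)].
  assert (H : forall i, 0 <= x ^ i / INR (fact i)).
  { intros i. apply Rdiv_le_0_compat; [now apply pow_le|apply INR_fact_lt_0]. }
  destruct n as [|n]; [simpl; lra|].
  rewrite tech5. assert (H1 := cond_pos_sum _ n H). unfold Rdiv in *. lra.
Qed.

Lemma CV_radius_cube_exp (k : nat) (c : R) :
  CV_radius (fun j => cube_exp_coef k j * c ^ j) = p_infty.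
Proof.
  assert (H : forall r : R, Rbar_le r (CV_radius (fun j => cube_exp_coef k j * c ^ j))).
  { intros r. apply (CV_radius_ge _ _ (exp (Rabs (c * r)))). intros j.
    eapply Rle_trans; [|apply (pow_div_fact_le_exp _ j), Rabs_pos].
    rewrite Rmult_assoc, <- Rpow_mult_distr, Rabs_mult, <- RPow_abs.
    apply Rmult_le_compat_r; [apply pow_le, Rabs_pos|].
    rewrite Rabs_pos_eq; apply cube_exp_coef_bound. }
  destruct (CV_radius _) as [r| |]; [|reflexivity|destruct (H 0)].
  exfalso. specialize (H (r + 1)). simpl in H. lra.
Qed.

(** Peeling off one coordinate [x] replaces [c] by [c * x]; integrating the
    entire series termwise in [x] over [0,1] divides its [j]-th coefficient by
    [j + 1].  So each coordinate contributes one factor [1 / (j + 1)]. *)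
Lemma cube_RInt_exp (k : nat) : forall c : R,
  cube_RInt k (fun xs => exp (c * fold_right Rmult 1 xs)) = PSeries (cube_exp_coef k) c.
Proof.
  induction k as [|k IH]; intros c.
  - simpl. rewrite Rmult_1_r. symmetry. apply is_pseries_unique.
    eapply is_pseries_ext; [|apply is_exp_Reals]. intros n.
    unfold cube_exp_coef. simpl. field. apply INR_fact_neq_0.
  - cbn [cube_RInt].
    rewrite (RInt_ext _ (PSeries (fun j => cube_exp_coef k j * c ^ j))).
    + rewrite RInt_PSeries by (rewrite CV_radius_cube_exp; exact I).
      assert (Hr : Rbar_lt (Rabs 1) (CV_radius (fun j => cube_exp_coef k j * c ^ j)))
        by (rewrite CV_radius_cube_exp; exact I).
      unfold PSeries.
      rewrite (Series_incr_1 _).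
      * simpl (PS_Int _ 0). rewrite Rmult_0_l, Rplus_0_l. apply Series_ext.
        intros j. unfold PS_Int, cube_exp_coef. rewrite pow1.
        replace (j + 1)%nat with (S j) by lia. rewrite <- tech_pow_Rmult.
        assert (INR (S j) <> 0) by now apply not_0_INR.
        field. repeat split; try assumption; [apply INR_fact_neq_0|now apply pow_nonzero].
      * assert (Hs := is_pseries_RInt _ _ Hr). apply is_pseries_R in Hs.
        eexists; exact Hs.
    + intros x _.
      rewrite (cube_RInt_ext k _ (fun xs => exp (c * x * fold_right Rmult 1 xs)))
        by (intros xs; simpl; f_equal; ring).
      rewrite IH. apply Series_ext. intros j. rewrite Rpow_mult_distr. ring.
Qed.

(** * Reciprocal power series and Bernoulli numbers *)

(** Course-of-values recursion: [reciprocal_upto e n] tabulates the entries up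
    to index [n], so that each new entry may refer to all the earlier ones. *)
Fixpoint reciprocal_upto (e : nat -> R) (n : nat) : nat -> R :=
  match n with
  | O => fun _ => 1
  | S m => fun i => if (i <=? m)%nat then reciprocal_upto e m i
      else - sum_f_R0 (fun j => reciprocal_upto e m j * e (S m - j)%nat) m
  end.

Definition reciprocal (e : nat -> R) (n : nat) : R := reciprocal_upto e n n.

Lemma reciprocal_upto_eq (e : nat -> R) (n i : nat) : (i <= n)%nat ->
  reciprocal_upto e n i = reciprocal e i.
Proof.
  induction n as [|n IH]; intros H.
  - now replace i with O by lia.
  - destruct (Nat.eq_dec i (S n)) as [->|Hne]; [reflexivity|].
    cbn [reciprocal_upto]. rewrite (proj2 (Nat.leb_le i n)) by lia. apply IH; lia.
Qed.

Lemma reciprocal_S (e : nat -> R) (n : nat) :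
  reciprocal e (S n) = - sum_f_R0 (fun j => reciprocal e j * e (S n - j)%nat) n.
Proof.
  unfold reciprocal at 1. cbn [reciprocal_upto].
  rewrite (proj2 (Nat.leb_gt (S n) n)) by lia. f_equal.
  apply sum_eq; intros j Hj. now rewrite reciprocal_upto_eq.
Qed.

(** [reciprocal e] is the coefficient sequence of the formal inverse of the power
    series [e]. *)
Lemma PS_mult_reciprocal (e : nat -> R) (n : nat) : e O = 1 ->
  PS_mult (reciprocal e) e n = match n with O => 1 | S _ => 0 end.
Proof.
  intros He. unfold PS_mult. destruct n as [|n].
  - simpl. unfold reciprocal; simpl. rewrite He; ring.
  - rewrite tech5, Nat.sub_diag, He, reciprocal_S. ring.
Qed.

Lemma sum_half_pow (n : nat) : sum_f_R0 (fun j => (/ 2) ^ (S n - j)) n = 1 - (/ 2) ^ S n.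
Proof.
  induction n as [|n IH]; [simpl; lra|].
  rewrite tech5, (sum_eq _ (fun j => (/ 2) ^ (S n - j) * (/ 2))).
  - rewrite <- scal_sum, IH. replace (S (S n) - S n)%nat with 1%nat by lia.
    simpl. field.
  - intros j Hj. replace (S (S n) - j)%nat with (S (S n - j)) by lia. simpl. ring.
Qed.

(** Strong induction on the recursion: the new entry is at most
    [1/2 + 1/4 + ... < 1].  This replaces any knowledge of the poles of the
    reciprocal function, at the price of a non-optimal radius. *)
Lemma reciprocal_bound (e : nat -> R) (n : nat) :
  (forall m, Rabs (e (S m)) <= (/ 2) ^ S m) -> Rabs (reciprocal e n) <= 1.
Proof.
  intros He. induction n as [n IH] using (well_founded_induction lt_wf).
  destruct n as [|n]; [unfold reciprocal; simpl; rewrite Rabs_R1; lra|].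
  rewrite reciprocal_S, Rabs_Ropp.
  eapply Rle_trans; [apply Rsum_abs|].
  apply Rle_trans with (sum_f_R0 (fun j => (/ 2) ^ (S n - j)) n).
  - apply sum_Rle; intros j Hj. rewrite Rabs_mult.
    rewrite <- (Rmult_1_l ((/ 2) ^ _)).
    apply Rmult_le_compat; try apply Rabs_pos; [apply IH; lia|].
    replace (S n - j)%nat with (S (n - j)) by lia. apply He.
  - rewrite sum_half_pow. generalize (pow_le (/ 2) (S n)). lra.
Qed.

Definition expm1_div_coef (m : nat) : R := / INR (fact (S m)).

Lemma expm1_div_coef_bound (m : nat) : 0 <= expm1_div_coef m <= (/ 2) ^ m.
Proof.
  unfold expm1_div_coef. assert (H := INR_fact_lt_0 (S m)).
  split; [left; now apply Rinv_0_lt_compat|].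
  rewrite pow_inv. apply Rinv_le_contravar; [apply pow_lt; lra|].
  clear H. induction m as [|m IH]; [simpl; lra|].
  rewrite fact_simpl, mult_INR. rewrite <- tech_pow_Rmult.
  apply Rmult_le_compat; try lra; [apply pow_le; lra|].
  rewrite !S_INR. generalize (pos_INR m). lra.
Qed.

Lemma is_pseries_expm1_div (t : R) : t <> 0 -> is_pseries expm1_div_coef t ((exp t - 1) / t).
Proof.
  intros Ht. assert (H := is_pseries_decr_1 _ t (/ t) _ (Rinv_l t Ht) (is_exp_Reals t)).
  replace ((exp t - 1) / t) with (scal (/ t) (plus (exp t) (opp (/ INR (fact 0))))); [exact H|].
  unfold scal, plus, opp; simpl. unfold mult; simpl. field. exact Ht.
Qed.

Lemma reciprocal_expm1_div_bound (n : nat) : Rabs (reciprocal expm1_div_coef n) <= 1.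
Proof.
  apply reciprocal_bound. intros m. rewrite Rabs_pos_eq; apply expm1_div_coef_bound.
Qed.

Lemma CV_radius_reciprocal_expm1_div : Rbar_le 1 (CV_radius (reciprocal expm1_div_coef)).
Proof.
  apply (CV_radius_ge _ _ 1). intros n. rewrite pow1, Rmult_1_r.
  apply reciprocal_expm1_div_bound.
Qed.

Lemma is_pseries_bernoulli (t : R) : 0 < Rabs t < 1 ->
  is_pseries (reciprocal expm1_div_coef) t (t / (exp t - 1)).
Proof.
  intros Ht. assert (Ht0 : t <> 0).
  { intros ->. rewrite Rabs_R0 in Ht. lra. }
  assert (Rb := CV_radius_reciprocal_expm1_div).
  assert (Re : Rbar_le 1 (CV_radius expm1_div_coef)).
  { apply (CV_radius_ge _ _ 1). intros n. rewrite pow1, Rmult_1_r.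
    rewrite Rabs_pos_eq; [|apply expm1_div_coef_bound].
    eapply Rle_trans; [apply expm1_div_coef_bound|].
    rewrite <- (pow1 n). apply pow_incr. lra. }
  assert (Hb : Rbar_lt (Rabs t) (CV_radius (reciprocal expm1_div_coef))).
  { eapply Rbar_lt_le_trans; [|exact Rb]. apply Ht. }
  assert (He : Rbar_lt (Rabs t) (CV_radius expm1_div_coef)).
  { eapply Rbar_lt_le_trans; [|exact Re]. apply Ht. }
  assert (Hp := PSeries_correct _ _ (CV_radius_inside _ _ Hb)).
  assert (Hm := is_pseries_mult _ _ _ _ _ Hp (is_pseries_expm1_div t Ht0) Hb He).
  assert (H1 : is_pseries (PS_mult (reciprocal expm1_div_coef) expm1_div_coef) t 1).
  { apply is_pseries_of_sums. eapply is_lim_seq_ext; [|apply is_lim_seq_const].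
    assert (He0 : expm1_div_coef 0 = 1) by (unfold expm1_div_coef; simpl; field).
    intros n. symmetry. rewrite (sum_f_R0_single _ O n); [|lia|].
    - rewrite PS_mult_reciprocal by exact He0. simpl; ring.
    - intros [|i] _ Hi; [lia|]. rewrite PS_mult_reciprocal by exact He0. ring. }
  assert (E : PSeries (reciprocal expm1_div_coef) t * ((exp t - 1) / t) = 1).
  { rewrite <- (is_pseries_unique _ _ _ Hm). now apply is_pseries_unique. }
  replace (t / (exp t - 1)) with (PSeries (reciprocal expm1_div_coef) t); [exact Hp|].
  assert (Hx : exp t - 1 <> 0).
  { intros Hx. rewrite Hx in E. unfold Rdiv in E. lra. }
  apply (Rmult_eq_reg_r ((exp t - 1) / t)).
  - rewrite E. field. now split.
  - intros Hz. rewrite Hz in E. lra.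
Qed.

Lemma bernoulli_eq (n : nat) : bernoulli n = reciprocal expm1_div_coef n * INR (fact n).
Proof.
  apply (egf_coef_eq (fun n => reciprocal expm1_div_coef n * INR (fact n))).
  exists (mkposreal 1 Rlt_0_1). intros t Ht Hne.
  change (Rabs (t - 0) < 1) in Ht. rewrite Rminus_0_r in Ht.
  eapply is_pseries_ext; [|apply is_pseries_bernoulli; split; [now apply Rabs_pos_lt|exact Ht]].
  intros m; simpl. field. apply INR_fact_neq_0.
Qed.

(** * The Daehee numbers *)

(** Coefficients of the exponential generating function of the Daehee numbers in
    the variable [u = ln (1 + t)]. *)
Definition daehee_log_coef (lam : R) (k n : nat) : R :=
  sum_n (fun l => Binomial.C n l *
      (lam ^ (n - l) * bernoulli l / INR (n - l + 1) ^ k)) n.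

Lemma daehee_log_coef_eq (lam : R) (k n : nat) :
  daehee_log_coef lam k n / INR (fact n)
  = PS_mult (reciprocal expm1_div_coef) (fun j => cube_exp_coef k j * lam ^ j) n.
Proof.
  unfold daehee_log_coef, PS_mult, Rdiv at 1. rewrite sum_n_Reals, Rmult_comm, scal_sum.
  apply sum_eq; intros l Hl. rewrite bernoulli_eq. unfold Binomial.C, cube_exp_coef.
  assert (H : INR (n - l + 1) <> 0) by (apply not_0_INR; lia).
  field. repeat split; try apply INR_fact_neq_0. now apply pow_nonzero.
Qed.

(** Each of the [n + 1] terms of the convolution is at most [(1 + |lam|)^n]; the
    factor [2 ^ n] absorbs their number. *)
Lemma daehee_log_coef_bound (lam : R) (k n : nat) :
  Rabs (daehee_log_coef lam k n) <= 1 * (2 * (1 + Rabs lam)) ^ n * INR (fact n).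
Proof.
  assert (Hf := INR_fact_lt_0 n).
  replace (daehee_log_coef lam k n) with (daehee_log_coef lam k n / INR (fact n) * INR (fact n))
    by (field; lra).
  rewrite Rabs_mult, (Rabs_pos_eq (INR _)), Rmult_1_l by lra.
  apply Rmult_le_compat_r; [lra|]. rewrite daehee_log_coef_eq. unfold PS_mult.
  eapply Rle_trans; [apply Rsum_abs|].
  apply Rle_trans with (sum_f_R0 (fun _ => (1 + Rabs lam) ^ n) n).
  - apply sum_Rle; intros l Hl.
    assert (Hlam := Rabs_pos lam).
    assert (Hb : Rabs (reciprocal expm1_div_coef l) <= 1).
    { apply reciprocal_expm1_div_bound. }
    assert (Hc : Rabs (cube_exp_coef k (n - l)) <= 1).
    { assert (Hc := cube_exp_coef_bound k (n - l)). rewrite Rabs_pos_eq by apply Hc.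
      eapply Rle_trans; [apply Hc|]. rewrite <- Rinv_1.
      apply Rinv_le_contravar; [lra|]. apply (le_INR 1), lt_O_fact. }
    assert (Hp : Rabs (lam ^ (n - l)) <= (1 + Rabs lam) ^ n).
    { rewrite <- RPow_abs. apply Rle_trans with ((1 + Rabs lam) ^ (n - l)).
      - apply pow_incr; lra.
      - apply Rle_pow; [lra|lia]. }
    rewrite !Rabs_mult, <- Rmult_assoc.
    rewrite <- (Rmult_1_l ((1 + Rabs lam) ^ n)).
    apply Rmult_le_compat; try apply Rabs_pos; [| |exact Hp].
    + apply Rmult_le_pos; apply Rabs_pos.
    + rewrite <- (Rmult_1_l 1). apply Rmult_le_compat; try apply Rabs_pos; assumption.
  - rewrite sum_cte, Rpow_mult_distr, Rmult_comm.
    apply Rmult_le_compat_r; [apply pow_le; generalize (Rabs_pos lam); lra|].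
    clear. induction n as [|n IH]; [simpl; lra|].
    rewrite S_INR, <- tech_pow_Rmult. rewrite S_INR in IH |- *.
    generalize (pos_INR n). lra.
Qed.

(** With [1 + t = exp u], the prefactor [ln (1 + t) / t] is [u / (exp u - 1)] and
    the integrand is the exponential of [lam * u] times the product of the
    coordinates: the product of the two series in [u] is a binomial convolution. *)
Lemma daehee_gf_eq (lam : R) (k : nat) (t : R) :
  t <> 0 -> Rabs t < 1 -> Rabs (ln (1 + t)) < 1 ->
  daehee_gf lam k t
  = PSeries (fun n => daehee_log_coef lam k n / INR (fact n)) (ln (1 + t)).
Proof.
  intros Ht Ht1 Hu. apply Rabs_def2 in Ht1.
  set (u := ln (1 + t)) in *.
  assert (Het : exp u = 1 + t) by (apply exp_ln; lra).
  assert (Hu0 : u <> 0).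
  { intros E. rewrite E, exp_0 in Het. lra. }
  assert (Rb : Rbar_lt (Rabs u) (CV_radius (reciprocal expm1_div_coef))).
  { apply (Rbar_lt_le_trans _ 1); [exact Hu|apply CV_radius_reciprocal_expm1_div]. }
  assert (Rc : Rbar_lt (Rabs u) (CV_radius (fun j => cube_exp_coef k j * lam ^ j))).
  { rewrite CV_radius_cube_exp. exact I. }
  rewrite (PSeries_ext _ _ u (daehee_log_coef_eq lam k)), PSeries_mult by assumption.
  unfold daehee_gf. f_equal.
  - symmetry. apply is_pseries_unique.
    fold u. replace (u / t) with (u / (exp u - 1)) by (rewrite Het; f_equal; ring).
    apply is_pseries_bernoulli. split; [now apply Rabs_pos_lt|exact Hu].
  - transitivity (PSeries (cube_exp_coef k) (lam * u)).
    + rewrite <- cube_RInt_exp. apply cube_RInt_ext. intros xs.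
      unfold Rpower. fold u. f_equal; ring.
    + apply Series_ext. intros j. rewrite Rpow_mult_distr. ring.
Qed.

Lemma has_egf_daehee (lam : R) (k : nat) :
  has_egf (fun n => stirling1_transform n (daehee_log_coef lam k)) (daehee_gf lam k).
Proof.
  assert (HR : 0 < 2 * (1 + Rabs lam)) by (generalize (Rabs_pos lam); lra).
  assert (H1 := egf_comp_ln_1p _ 1 _ HR (daehee_log_coef_bound lam k)).
  assert (Hc : continuous (fun t => ln (1 + t)) 0).
  { apply (ex_derive_continuous (fun t => ln (1 + t))). auto_derive. lra. }
  assert (H2 : locally 0 (fun t => Rabs (ln (1 + t)) < 1)).
  { apply (Hc (fun y => Rabs y < 1)). apply locally_open_interval.
    rewrite Rplus_0_r, ln_1, Rabs_R0. lra. }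
  assert (H3 : locally 0 (fun t => Rabs t < 1)).
  { apply locally_open_interval. rewrite Rabs_R0. lra. }
  generalize (filter_and _ _ H1 (filter_and _ _ H2 H3)).
  unfold has_egf, locally', within. apply filter_imp.
  intros t [P [Hu Ht]] Hne. now rewrite daehee_gf_eq.
Qed.

Theorem theorem2p6 (lam : R) (k : nat) (hk : (1 <= k)%nat) (n : nat) :
  sum_n (fun m => daehee lam k m * stirling2 n m) n
  = sum_n (fun l => Binomial.C n l *
      (lam ^ (n - l) * bernoulli l / INR (n - l + 1) ^ k)) n.
Proof.
  change (sum_n (fun m => daehee lam k m * stirling2 n m) n = daehee_log_coef lam k n).
  rewrite <- (stirling2_inverts (daehee_log_coef lam k) n).
  apply sum_n_ext. intros m. unfold daehee.
  now rewrite (egf_coef_eq _ _ m (has_egf_daehee lam k)).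
Qed.
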